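(* Let $X$ be a topological space, let $\Delta_X\subseteq X$ be a closed and discrete subset partitioned into pairwise disjoint subsets $\Delta_X(k)$, $k\in\mathbb Z$, and for each $k\in\mathbb Z$ let $I_X(k)$ be a proper ideal on $\Delta_X(k)$. Suppose that for every $k\in\mathbb Z$ and every open $V\subseteq X$, if $\Delta_X(k)\setminus V\in I_X(k)$, then $\Delta_X(k-1)\setminus cl_X(V)\in I_X(k-1)$. Let $\mathbf Y^*=\mathbf Y_X\cup\{-\infty,+\infty\}$ be the space defined in the context. If $f:\mathbf Y^*\to\mathbb R$ is a continuous real valued function, then $f(+\infty)=f(-\infty)$.
   Context: Construction of $\mathbf Y=\mathbf Y_X$. For $x\in X\setminus\Delta_X$ and $k\in\mathbb Z$ put $\mathbf x_k=(k,x)$; for $x\in\Delta_X(k)$ put $\mathbf x_k=\{(k,x),(k+1,x)\}$ (so for $x\in\Delta_X$ the point $\mathbf x_k$ is defined only for the unique $k$ with $x\in\Delta_X(k)$). Let $\mathbf Y_X$ be the set of all points $\mathbf x_k$ so defined. Its topology is generated by: the sets $\{\mathbf x_k:x\in V\}$, for $k\in\mathbb Z$ and $V\subseteq X\setminus\Delta_X$ open in $X$; and the sets $\{\mathbf x_k:x\in V\cap((X\setminus\Delta_X)\cup\Delta_X(k))\}\cup\{\mathbf x_{k+1}:x\in V\setminus\Delta_X\}$, for $k\in\mathbb Z$ and $V\subseteq X$ open. Put $\Delta_{\mathbf Y}(k)=\{\mathbf x_k:x\in\Delta_X(k)\}$ and $\mathbf Y_k=\{\mathbf x_k:x\in X\setminus\Delta_X\}$.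 Topology of $\mathbf Y^*=\mathbf Y\cup\{-\infty,+\infty\}$, where $\pm\infty$ are distinct new points: open sets of $\mathbf Y$ are open; the sets $\mathcal V^+_m=\{+\infty\}\cup\bigcup\{\mathbf Y_n:n\geqslant m\}\cup\bigcup\{\Delta_{\mathbf Y}(n):n>m\}$, $m\in\mathbb Z$, form a base at $+\infty$; the sets $\mathcal V^-_m=\{-\infty\}\cup\bigcup\{\mathbf Y_n:n\leqslant m\}\cup\bigcup\{\Delta_{\mathbf Y}(n):n<m\}$, $m\in\mathbb Z$, form a base at $-\infty$. *)

(* Defs.v *)
From HB Require Import structures.
From mathcomp Require Import all_boot all_order all_algebra.
From mathcomp Require Import finmap.
From mathcomp Require Import all_classical all_reals.
From mathcomp Require Import topology normedtype.
Set Implicit Arguments.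
Unset Strict Implicit.
Unset Printing Implicit Defensive.
Import Order.TTheory GRing.Theory Num.Theory.
Import numFieldNormedType.Exports.
Local Open Scope classical_set_scope.
Local Open Scope ring_scope.

Definition proper_set_ideal (T : Type) (A : set T) (I : set (set T)) : Prop :=
  [/\ (forall B, I B -> B `<=` A),
      I set0,
      (forall B C, I C -> B `<=` C -> I B),
      (forall B C, I B -> I C -> I (B `|` C)) &
      ~ I A].

(* The point x_k is encoded by its data: the level k and the underlying point
   x, subject to x \notin Delta or x \in Delta(k). When Delta is the disjoint
   union of the Delta(k), a point x of Delta thus occurs at exactly one level
   k, where (k, x) stands for the two-element set {(k, x), (k + 1, x)}. *)
Record Yspace (X : Type) (Delta : set X) (D : int -> set X) := YPoint {
  ylevel : int;
  ypoint : X;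
  YspaceP : ~ Delta ypoint \/ D ylevel ypoint
}.

HB.instance Definition _ X (Delta : set X) D := gen_eqMixin (Yspace Delta D).
HB.instance Definition _ X (Delta : set X) D :=
  gen_choiceMixin (Yspace Delta D).

Section Yspace_topology.
Context {X : topologicalType} (Delta : set X) (D : int -> set X).
Local Notation Y := (Yspace Delta D).

Definition layer_open (k : int) (V : set X) : set Y :=
  [set y | ylevel y = k /\ V (ypoint y)].

(* Membership in ~` Delta `|` D k is automatic when ylevel y = k. *)
Definition glue_open (k : int) (V : set X) : set Y :=
  [set y | ylevel y = k /\ (V `&` (~` Delta `|` D k)) (ypoint y)] `|`
  [set y | ylevel y = k + 1 /\ (V `\` Delta) (ypoint y)].

Definition Yspace_subbase : set (set Y) :=
  [set W | exists k V, [/\ open V, V `<=` ~` Delta & W = layer_open k V]] `|`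
  [set W | exists k V, open V /\ W = glue_open k V].

HB.instance Definition _ :=
  isSubBaseTopological.Build Y Yspace_subbase id.

Definition Ylayer (k : int) : set Y :=
  [set y | ylevel y = k /\ ~ Delta (ypoint y)].

Definition Ydelta (k : int) : set Y :=
  [set y | ylevel y = k /\ D k (ypoint y)].

End Yspace_topology.

Arguments Ylayer {X} Delta D k.
Arguments Ydelta {X} Delta D k.

Inductive Ystar (X : Type) (Delta : set X) (D : int -> set X) :=
  | Yin of Yspace Delta D
  | PInf
  | NInf.

Arguments Yin {X Delta D}.
Arguments PInf {X Delta D}.
Arguments NInf {X Delta D}.

HB.instance Definition _ X (Delta : set X) D :=
  gen_eqMixin (Ystar Delta D).
HB.instance Definition _ X (Delta : set X) D :=
  gen_choiceMixin (Ystar Delta D).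

Section Ystar_topology.
Context {X : topologicalType} (Delta : set X) (D : int -> set X).
Local Notation Y := (Yspace Delta D).
Local Notation Ys := (Ystar Delta D).

Definition Vpinf (m : int) : set Ys :=
  [set PInf] `|`
  Yin @` (\bigcup_(n in [set n : int | m <= n]) Ylayer Delta D n `|`
          \bigcup_(n in [set n : int | m < n]) Ydelta Delta D n).

Definition Vninf (m : int) : set Ys :=
  [set NInf] `|`
  Yin @` (\bigcup_(n in [set n : int | n <= m]) Ylayer Delta D n `|`
          \bigcup_(n in [set n : int | n < m]) Ydelta Delta D n).

(* W is open iff its trace on Y is open and it contains a basic neighbourhood
   of each point at infinity that it contains; that the Vpinf m and Vninf m
   are themselves open (for closed Delta) is proved below. *)
Definition Ystar_open (W : set Ys) : Prop :=
  [/\ open (Yin @^-1` W : set Y),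
      (W PInf -> exists m, Vpinf m `<=` W) &
      (W NInf -> exists m, Vninf m `<=` W)].

Lemma Ystar_openT : Ystar_open setT.
Proof.
by split=> [|_|_]; [rewrite preimage_setT; exact: openT|exists 0|exists 0].
Qed.

Lemma Ystar_openI : setI_closed Ystar_open.
Proof.
move=> A B [oA pA nA] [oB pB nB]; split.
- by rewrite preimage_setI; exact: openI.
- move=> [/pA[m mA] /pB[n nB']]; exists (Num.max m n).
  move=> _ [->|[y [[k kmn yk]|[k kmn yk]] <-]].
  + by split; [apply: mA; left|apply: nB'; left].
  + move: kmn; rewrite /= ge_max => /andP[mk nk].
    by split; [apply: mA|apply: nB']; right; exists y => //; left; exists k.
  + move: kmn; rewrite /= gt_max => /andP[mk nk].
    by split; [apply: mA|apply: nB']; right; exists y => //; right; exists k.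
- move=> [/nA[m mA] /nB[n nB']]; exists (Num.min m n).
  move=> _ [->|[y [[k kmn yk]|[k kmn yk]] <-]].
  + by split; [apply: mA; left|apply: nB'; left].
  + move: kmn; rewrite /= le_min => /andP[mk nk].
    by split; [apply: mA|apply: nB']; right; exists y => //; left; exists k.
  + move: kmn; rewrite /= lt_min => /andP[mk nk].
    by split; [apply: mA|apply: nB']; right; exists y => //; right; exists k.
Qed.

Lemma Ystar_open_bigU (J : Type) (f : J -> set Ys) :
  (forall i, Ystar_open (f i)) -> Ystar_open (\bigcup_i f i).
Proof.
move=> of_; split.
- by rewrite preimage_bigcup; apply: bigcup_open => i _; case: (of_ i).
- move=> [i _ fi]; have [_ /(_ fi)[m mf] _] := of_ i.
  by exists m => z /mf fz; exists i.
- move=> [i _ fi]; have [_ _ /(_ fi)[m mf]] := of_ i.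
  by exists m => z /mf fz; exists i.
Qed.

HB.instance Definition _ := isOpenTopological.Build Ys
  Ystar_openT Ystar_openI Ystar_open_bigU.

Lemma Yspace_subbase_open (W : set Y) : Yspace_subbase W -> open W.
Proof.
move=> sW; exists [set W]; last by rewrite bigcup_set1.
move=> _ ->; exists [fset W]%fset.
  by move=> U /fset1P ->; exact/mem_set.
rewrite eqEsubset; split=> y Wy; first by apply: (Wy W); exact/fset1P.
by move=> U /fset1P ->.
Qed.

Lemma Ylayer_open (k : int) : closed Delta -> open (Ylayer Delta D k).
Proof.
move=> cD; apply: Yspace_subbase_open; left; exists k, (~` Delta).
by split=> //; exact: closed_openC.
Qed.

Lemma Vpinf_open (m : int) : closed Delta -> open (Vpinf m).
Proof.
move=> cD; split; [|by move=> _; exists m|by case=> // -[]].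
have -> : Yin @^-1` Vpinf m =
    Ylayer Delta D m `|` \bigcup_(n in [set n | m < n]) glue_open n setT.
  rewrite eqEsubset; split=> y /=.
  - move=> [//|[z [[n /= mn yn]|[n /= mn [yn Dy]]] [<-]]].
    + move: mn; rewrite le_eqVlt => /orP[/eqP ->|mn]; first by left.
      right; exists n => //; left; case: yn => yn Dy.
      by split=> //; split=> //; left.
    + by right; exists n => //; left; split=> //; split=> //; right.
  - move=> [yn|[n /= mn [[yn [_ [Dy|Dy]]]|[yn [_ Dy]]]]]; right; exists y => //.
    + by left; exists m => /=.
    + by left; exists n => //=; exact: ltW.
    + by right; exists n.
    + by left; exists (n + 1); rewrite //= ltW// (lt_trans mn)// ltrDl.
apply: openU; first exact: Ylayer_open.
apply: bigcup_open => n _; apply: Yspace_subbase_open.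
by right; exists n, setT; split=> //; exact: openT.
Qed.

Lemma Vninf_open (m : int) : closed Delta -> open (Vninf m).
Proof.
move=> cD; split; [|by case=> // -[]|by move=> _; exists m].
have -> : Yin @^-1` Vninf m =
    Ylayer Delta D m `|` \bigcup_(n in [set n | n < m]) glue_open n setT.
  rewrite eqEsubset; split=> y /=.
  - move=> [//|[z [[n /= mn yn]|[n /= mn [yn Dy]]] [<-]]].
    + move: mn; rewrite le_eqVlt => /orP[/eqP <-|mn]; first by left.
      right; exists n => //; left; case: yn => yn Dy.
      by split=> //; split=> //; left.
    + by right; exists n => //; left; split=> //; split=> //; right.
  - move=> [yn|[n /= mn [[yn [_ [Dy|Dy]]]|[yn [_ Dy]]]]]; right; exists y => //.
    + by left; exists m => /=.
    + by left; exists n => //=; exact: ltW.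
    + by right; exists n.
    + by left; exists (n + 1); rewrite //= lezD1.
apply: openU; first exact: Ylayer_open.
apply: bigcup_open => n _; apply: Yspace_subbase_open.
by right; exists n, setT; split=> //; exact: openT.
Qed.

Lemma Yin_open (U : set Y) : open U -> open (Yin @` U : set Ys).
Proof.
move=> oU; split; [|by move=> []|by move=> []].
rewrite (_ : _ @^-1` _ = U)// eqEsubset; split=> y /=; last by exists y.
by move=> [z Uz [<-]].
Qed.

Lemma nbhs_PInf (A : set Ys) : closed Delta ->
  nbhs (PInf : Ys) A <-> exists m, Vpinf m `<=` A.
Proof.
move=> cD; split.
  rewrite nbhsE => -[W [[_ pW _] Wp] WA]; have [m mW] := pW Wp.
  by exists m; exact: subset_trans WA.
move=> [m mA]; rewrite nbhsE; exists (Vpinf m) => //.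
by split; [exact: Vpinf_open|left].
Qed.

Lemma nbhs_NInf (A : set Ys) : closed Delta ->
  nbhs (NInf : Ys) A <-> exists m, Vninf m `<=` A.
Proof.
move=> cD; split.
  rewrite nbhsE => -[W [[_ _ pW] Wp] WA]; have [m mW] := pW Wp.
  by exists m; exact: subset_trans WA.
move=> [m mA]; rewrite nbhsE; exists (Vninf m) => //.
by split; [exact: Vninf_open|left].
Qed.

End Ystar_topology.

(* Main.v *)
Require Import Defs.
From mathcomp Require Import all_boot all_order all_algebra.
From mathcomp Require Import all_classical all_reals.
From mathcomp Require Import topology normedtype.
From mathcomp Require Import zify.
Set Implicit Arguments.
Unset Strict Implicit.
Unset Printing Implicit Defensive.
Import Order.TTheory GRing.Theory Num.Theory.
Import numFieldNormedType.Exports.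
Local Open Scope classical_set_scope.
Local Open Scope ring_scope.

(** The ideals measure which part of each [D k] is negligible.  Fix [t] above
    [f PInf].  On high levels [f < t] holds at every glued point, and the
    hypothesis linking consecutive ideals carries this estimate downwards, up
    to negligible sets and an arbitrarily small increase of the bound: a glued
    point of level [k] has a neighbourhood reaching into the layer [k], so
    [f < s] at almost all points of [D k] yields an open [V] covering almost
    all of [D k] with [f < s] on the copy of [V] in the layer [k]; and a point
    of [D (k - 1)] adherent to [V] is glued to that same layer, so [f <= s]
    there by continuity ([sublevel_step]).  The increases can be made to
    accumulate to less than any given amount, because only finitely many steps
    separate a neighbourhood of [PInf] from one of [NInf].  On low levels [f]
    is close to [f NInf] at every glued point, and since the ideals are proper
    some glued point there also satisfies [f < t].  Hence
    [f NInf <= f PInf] ([NInf_le_PInf]), and the same bound for [- f] gives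
    equality. *)

(** Only the gluing sets of level [k], among the subbasic open sets, contain a
    glued point of that level, and each of them reaches into both adjacent
    layers over a neighbourhood of the underlying point. *)
Lemma near_Ydelta (X : topologicalType) (Delta : set X) (D : int -> set X)
    (k : int) (y : Yspace Delta D) (W : set (Yspace Delta D)) :
  D k `<=` Delta -> Ydelta Delta D k y -> nbhs y W ->
  \forall u \near ypoint y, forall z : Yspace Delta D,
    ypoint z = u -> ~ Delta u -> ylevel z = k \/ ylevel z = k + 1 -> W z.
Proof.
move=> DkDelta [yk Dy].
pose F (A : set (Yspace Delta D)) := nbhs (ypoint y) [set u |
  forall z : Yspace Delta D, ypoint z = u -> ~ Delta u ->
    ylevel z = k \/ ylevel z = k + 1 -> A z].
have FF : Filter F.
  split=> [|A B FA FB|A B AB].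
  - by rewrite /F; apply: filterE.
  - rewrite /F in FA FB *; apply: filterS2 FA FB => u Au Bu z zu Du zk.
    by split; [exact: Au zu Du zk|exact: Bu zu Du zk].
  - rewrite /F; apply: filterS => u Au z zu Du zk.
    by apply: AB; exact: Au zu Du zk.
rewrite nbhsE => -[U [[C Cfin <-] [B CB By]] UW].
have BW : B `<=` W by move=> z Bz; apply: UW; exists B.
suff FB : F B by exact: filterS BW FB.
have [G Gsub BE] := Cfin _ CB; rewrite -BE in By *.
apply: filter_bigI => A AG; have /set_mem := Gsub _ AG.
move=> [[k' [V [oV VD AE]]]|[k' [V [oV AE]]]]; have := By _ AG; rewrite AE.
  by move=> [_ /VD]; case; exact: DkDelta.
move=> [[yk' [Vy _]]|[_ [_ []]]]; last exact: DkDelta.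
rewrite -yk' yk; apply: filterS (open_nbhs_nbhs (conj oV Vy)) => u Vu z zu Du.
by case=> zk; [left|right]; rewrite /= zu; split=> //; split=> //; left.
Qed.

Lemma nbhs_Yin (X : topologicalType) (Delta : set X) (D : int -> set X)
    (y : Yspace Delta D) (W : set (Ystar Delta D)) :
  nbhs (Yin y : Ystar Delta D) W -> nbhs y (Yin @^-1` W).
Proof.
rewrite nbhsE => -[U [[oU _ _] Uy] UW].
by rewrite nbhsE; exists (Yin @^-1` U) => // z /UW.
Qed.

Definition sublevel (R : realType) (X : topologicalType) (Delta : set X)
    (D : int -> set X) (f : Ystar Delta D -> R) (k : int) (t : R) : set X :=
  @ypoint X Delta D @` (Ydelta Delta D k `&` [set y | f (Yin y) < t]).

Section Propagation.
Context (R : realType) (X : topologicalType) (Delta : set X)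
  (D : int -> set X) (I : int -> set (set X)).
Hypotheses (Delta_closed : closed Delta)
  (Delta_discrete : Delta `<=` isolated Delta)
  (D_cover : \bigcup_k D k = Delta)
  (D_disjoint : trivIset setT D)
  (I_ideal : forall k : int, proper_set_ideal (D k) (I k))
  (I_step : forall (k : int) (V : set X), open V ->
     I k (D k `\` V) -> I (k - 1) (D (k - 1) `\` closure V)).

Let DDelta k : D k `<=` Delta.
Proof. by rewrite -D_cover => x Dx; exists k. Qed.

Let near_isolated x : Delta x -> \forall u \near x, Delta u -> u = x.
Proof.
move=> /Delta_discrete[_ [V Vx VD]]; apply: filterS Vx => u Vu Du.
by have : (V `&` Delta) u by []; rewrite VD.
Qed.

(** Layer [k] is the common neighbour of the glued points of levels [k] and
    [k - 1]: small values at the former spread into the layer, and closure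
    brings them to the latter. *)
Lemma sublevel_step (f : Ystar Delta D -> R) (k : int) (s t : R) :
  continuous f -> s < t ->
  I k (D k `\` sublevel f k s) ->
  I (k - 1) (D (k - 1) `\` sublevel f (k - 1) t).
Proof.
move=> cf st Is.
(* Keeping S disjoint from the other D j ensures that the points of S close
   to a given point of D (k - 1) lie off Delta, hence lift to the layer k. *)
pose S := [set u | (Delta u -> D k u) /\
  (~ Delta u -> forall z : Yspace Delta D,
     ypoint z = u -> ylevel z = k -> f (Yin z) < s)].
have sub_S : sublevel f k s `<=` S°.
  move=> _ [y [ydk fy] <-]; have [_ Dy] := ydk.
  have fW : nbhs y [set z | f (Yin z) < s].
    by apply: (@nbhs_Yin _ _ _ y [set w | f w < s]); exact: cvgr_lt (cf _) _ fy.
  apply: filterS2 (near_isolated (DDelta Dy)) (near_Ydelta (@DDelta k) ydk fW).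
  move=> u isou fu; split=> [/isou -> //|Du z zu zk].
  by apply: fu zu Du _; left.
have [_ _ Isub _ _] := I_ideal k.
have {Is} /(I_step (open_interior S)) Icl : I k (D k `\` S°).
  by apply: Isub Is _ => x [Dx Sx]; split=> // /sub_S.
have [_ _ {}Isub _ _] := I_ideal (k - 1).
apply: Isub Icl _ => x [Dx fx]; split=> // clx; apply: fx.
pose y : Yspace Delta D := YPoint (or_intror Dx).
have ydk : Ydelta Delta D (k - 1) y by [].
exists y => //; split=> //=; apply: le_lt_trans st; rewrite leNgt; apply/negP.
move=> fy.
have fW : nbhs y [set z | s < f (Yin z)].
  by apply: (@nbhs_Yin _ _ _ y [set w | s < f w]); exact: cvgr_gt (cf _) _ fy.
have [u [/interior_subset[SD Sf] [isou fu]]] := clx _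
  (filterI (near_isolated (DDelta Dx)) (near_Ydelta (@DDelta _) ydk fW)).
have Du : ~ Delta u.
  move=> Du; have Dkx := SD Du; rewrite (isou Du) in Dkx.
  have : k = k - 1 by apply: D_disjoint => //; exists x.
  lia.
pose z : Yspace Delta D := YPoint (ylevel := k) (or_introl Du).
have := Sf Du z erefl erefl.
rewrite ltNge => /negP; apply; apply: ltW.
by apply: (fu z) => //; right; rewrite subrK.
Qed.

(** Inserting a midpoint in each step makes the loss in [sublevel_step]
    disappear for bounds ranging over an open half-line. *)
Lemma sublevel_down (f : Ystar Delta D -> R) (k : int) (t0 : R) :
  continuous f -> (forall t, t0 < t -> I k (D k `\` sublevel f k t)) ->
  forall (j : nat) t, t0 < t ->
    I (k - j%:Z) (D (k - j%:Z) `\` sublevel f (k - j%:Z) t).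
Proof.
move=> cf Ik; elim=> [|j IHj] t t0t; first by rewrite subr0; exact: Ik.
have -> : k - j.+1%:Z = k - j%:Z - 1 by lia.
have [t0s st] := midf_lt t0t.
exact: sublevel_step cf st (IHj _ t0s).
Qed.

Lemma NInf_le_PInf (f : Ystar Delta D -> R) :
  continuous f -> f NInf <= f PInf.
Proof.
move=> cf; rewrite leNgt; apply/negP => fPN.
have [Pt tN] := midf_lt fPN; set t := (_ / _) in Pt tN.
have [Ps st] := midf_lt Pt; set s := (_ / _) in Ps st.
have /(nbhs_PInf _ Delta_closed)[m mP] : nbhs (PInf : Ystar Delta D)
  [set w | f w < s] by exact: cvgr_lt (cf _) _ Ps.
have /(nbhs_NInf _ Delta_closed)[n nN] : nbhs (NInf : Ystar Delta D)
  [set w | t < f w] by exact: cvgr_gt (cf _) _ tN.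
have high r : s < r -> I (m + 1) (D (m + 1) `\` sublevel f (m + 1) r).
  move=> sr; have [_ I0 Isub _ _] := I_ideal (m + 1).
  apply: Isub I0 _ => x [Dx]; apply.
  exists (YPoint (or_intror Dx)) => //; split=> //=; apply: lt_trans sr.
  apply: mP; right; eexists; last by [].
  by right; exists (m + 1) => //=; rewrite ltrDl.
have := sublevel_down cf high `|(m + 1 - n)%R|.+1 st.
set l := _ - _ => Il.
have ln : l < n by rewrite /l; lia.
have [_ _ Isub _] := I_ideal l; apply.
apply: Isub Il _ => x Dx; split=> // -[y [ydl /= fy] _].
have : t < f (Yin y) by apply: nN; right; exists y => //; right; exists l.
by rewrite ltNge (ltW fy).
Qed.

End Propagation.

Theorem theorem9 (R : realType) (X : topologicalType) (Delta : set X)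
  (D : int -> set X) (I : int -> set (set X))
  (Delta_closed : closed Delta)
  (Delta_discrete : Delta `<=` isolated Delta)
  (D_cover : \bigcup_k D k = Delta)
  (D_disjoint : trivIset setT D)
  (I_ideal : forall k : int, proper_set_ideal (D k) (I k))
  (I_step : forall (k : int) (V : set X), open V ->
     I k (D k `\` V) -> I (k - 1) (D (k - 1) `\` closure V))
  (f : Ystar Delta D -> R) (f_continuous : continuous f) :
  f PInf = f NInf.
Proof.
have le := NInf_le_PInf Delta_closed Delta_discrete D_cover D_disjoint
  I_ideal I_step.
apply/eqP; rewrite eq_le (le R f)// andbT -lerN2.
by apply: (le R (fun w => - f w)) => w; apply: continuousN; exact: f_continuous.
Qed.
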